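(* Let $\mathcal{G}$ and $\hat{\mathcal{G}}$ be two undirected graphs with $N$ nodes, described by symmetric graph matrix descriptions $\mathbf{S}\in\mathbb{R}^{N\times N}$ and $\hat{\mathbf{S}}\in\mathbb{R}^{N\times N}$, respectively. Let $\mathbf{H}\in\mathbb{R}^{N\times(K+1)}$ be the coefficients of any node-variant graph filter. Given a constant $\varepsilon>0$, if $\|\hat{\mathbf{S}}-\mathbf{S}\|_2\le\varepsilon$, it holds that $$\Big\|\big(\boldsymbol{H}^{\mathrm{nv}}(\hat{\mathbf{S}})-\boldsymbol{H}^{\mathrm{nv}}(\mathbf{S})\big)\mathbf{x}\Big\|_2\le \varepsilon\, C\sqrt{N}\,(1+8N)\,\|\mathbf{x}\|_2+\mathcal{O}(\varepsilon^2),$$ where $\mathbf{x}\in\mathbb{R}^N$ is the input graph signal, $\boldsymbol{H}^{\mathrm{nv}}(\mathbf{S})$ and $\boldsymbol{H}^{\mathrm{nv}}(\hat{\mathbf{S}})$ are the node-variant graph filter with coefficients $\mathbf{H}$ on $\mathbf{S}$ and $\hat{\mathbf{S}}$, respectively, and where $C$ is the Lipschitz constant of the frequency responses at each node, i.e., $|\tilde h_t(\lambda_j)-\tilde h_t(\lambda_i)|\le C|\lambda_j-\lambda_i|$ for all $i,j,t\in\{1,\dots,N\}$.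
   Context: A graph matrix description of a graph with nodes $v_1,\dots,v_N$ and edge set $\mathcal{E}$ is a matrix $\mathbf{S}\in\mathbb{R}^{N\times N}$ with $[\mathbf{S}]_{ij}=0$ for all distinct $i,j$ such that $(v_j,v_i)\notin\mathcal{E}$. Eigenvalues of graph matrix descriptions are assumed distinct; $\lambda_1,\dots,\lambda_N$ are the eigenvalues of $\mathbf{S}$. The node-variant graph filter with coefficients $\mathbf{H}$ is $\boldsymbol{H}^{\mathrm{nv}}(\mathbf{S})=\sum_{k=0}^{K}\mathrm{diag}(\mathbf{h}^{(k)})\mathbf{S}^k$, where $\mathbf{h}^{(k)}\in\mathbb{R}^N$ is the $(k+1)$-th column of $\mathbf{H}$ and $\mathrm{diag}(\mathbf{a})$ is the diagonal matrix with the vector $\mathbf{a}$ on its diagonal; $\boldsymbol{H}^{\mathrm{nv}}(\hat{\mathbf{S}})$ is the same expression with $\hat{\mathbf{S}}$ in place of $\mathbf{S}$. With $h_{tk}=[\mathbf{h}^{(k)}]_t=[\mathbf{H}]_{t(k+1)}$, the frequency response at node $t$ is the polynomial $\tilde h_t(\lambda)=\sum_{k=0}^{K}h_{tk}\lambda^k$. $\|\cdot\|_2$ is the spectral norm for matrices and the Euclidean norm for vectors.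
   Formalization: C is taken as a Lipschitz constant of each frequency response on a set having every eigenvalue of S as a non-isolated point (e.g. an interval around the spectrum); with the inequality only at the eigenvalues the claim fails (N=1, response λ, C=0). *)

(* Defs.v *)
From HB Require Import structures.
From mathcomp Require Import all_boot all_order all_algebra.
From mathcomp Require Import all_classical all_reals all_analysis.

Set Implicit Arguments.
Unset Strict Implicit.
Unset Printing Implicit Defensive.

Import Order.TTheory GRing.Theory Num.Theory.
Import numFieldNormedType.Exports.

Local Open Scope classical_set_scope.
Local Open Scope ring_scope.

(* The library's norm on matrices and vectors is the max norm, hence the two  *)
(* definitions below.                                                         *)
Definition norm2 (R : realType) (n : nat) (x : 'cV[R]_n) : R :=
  Num.sqrt (\sum_(i < n) x i 0 ^+ 2).

Definition spectral_norm (R : realType) (m n : nat) (A : 'M[R]_(m, n)) : R :=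
  sup [set norm2 (A *m x) | x in [set x : 'cV[R]_n | norm2 x <= 1]].

(* [E j i] means (v_j, v_i) is an edge; diagonal entries of [S] are free.     *)
Definition graph_matrix (R : realType) (N : nat) (E : rel 'I_N)
    (S : 'M[R]_N) : Prop :=
  forall i j : 'I_N, i != j -> ~~ E j i -> S i j = 0.

(* [lam] lists the eigenvalues of [S] with their algebraic multiplicities;    *)
(* the eigenvalues are distinct when moreover [lam] is injective.             *)
Definition is_spectrum (R : realType) (N : nat) (S : 'M[R]_N)
    (lam : 'I_N -> R) : Prop :=
  char_poly S = \prod_(i < N) ('X - (lam i)%:P).

Definition nv_filter (R : realType) (N K : nat) (H : 'M[R]_(N, K.+1))
    (S : 'M[R]_N) : 'M[R]_N :=
  \sum_(k < K.+1) diag_mx (col k H)^T *m S ^+ k.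

Definition freq_response (R : realType) (N K : nat) (H : 'M[R]_(N, K.+1))
    (t : 'I_N) (l : R) : R :=
  \sum_(k < K.+1) H t k * l ^+ k.

(* [C] is a Lipschitz constant of [h], as a function of a real variable,      *)
(* around the points [lam i]: [h] is [C]-Lipschitz on some set [A] containing *)
(* every [lam i] as a non-isolated point, e.g. a nondegenerate interval or a  *)
(* neighbourhood of these points.  A polynomial of degree at least 2 is not   *)
(* Lipschitz on the whole line, while on the finite set of the [lam i] alone  *)
(* (an isolated set) the condition would say nothing about the variation of   *)
(* [h] when the [lam i] are perturbed.                                        *)
Definition lipschitz_constant (R : realType) (I : Type) (lam : I -> R)
    (h : R -> R) (C : R) : Prop :=
  exists2 A : set R,
    (forall i, A (lam i) /\ limit_point A (lam i)) & C.-lipschitz_A h.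

Lemma lipschitz_constant_le (R : realType) (I : Type) (lam : I -> R)
    (h : R -> R) (C : R) : lipschitz_constant lam h C ->
  forall i j, `|h (lam j) - h (lam i)| <= C * `|lam j - lam i|.
Proof.
case=> A Alam hC i j; have /= := hC (lam j, lam i).
by apply; split; [case: (Alam j) | case: (Alam i)].
Qed.

(* Main.v *)
(* To first order in [D = Shat - S], the [t]-th entry of the output difference
   is linear in [D]; in an orthonormal eigenbasis [V] of [S] it is given by the
   matrix [V D V^T] multiplied entrywise by the divided differences of the
   frequency response of node [t] at the pairs of eigenvalues.  Lipschitz
   continuity bounds these by [C], on the diagonal because the eigenvalues are
   limit points of the Lipschitz set.  Since the Frobenius norm of [D] is at
   most [sqrt N * eps], the first-order term is at most [N * C * eps * |x|],
   which is below the claimed bound.  The remainders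
   [Shat ^+ k - S ^+ k - pow_diff k S D S] are quadratic in [D], with constants
   depending only on [S] and [k] for bounded [eps]. *)
Require Import Defs.
From HB Require Import structures.
From mathcomp Require Import all_boot all_order all_algebra.
From mathcomp Require Import all_classical all_reals all_analysis.
From mathcomp Require Import ring lra.

Set Implicit Arguments.
Unset Strict Implicit.
Unset Printing Implicit Defensive.

Import Order.TTheory GRing.Theory Num.Theory.
Import numFieldNormedType.Exports.

Local Open Scope classical_set_scope.
Local Open Scope ring_scope.

(** * The Frobenius norm and its comparison with the spectral norm *)

(** Replaces the spectral norm in the estimates: multiplying a matrix entrywise by factors of size
    at most [C] visibly scales this norm by at most [C]. *)
Definition fnorm {R : realType} {m n : nat} (A : 'M[R]_(m, n)) : R :=
  Num.sqrt (\sum_(i < m) \sum_(j < n) A i j ^+ 2).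

Lemma sum_cauchy_schwarz (R : realType) (I : finType) (a b : I -> R) :
  (\sum_i a i * b i) ^+ 2 <= (\sum_i a i ^+ 2) * (\sum_i b i ^+ 2).
Proof.
(* Lagrange's identity *)
have : 0 <= \sum_i \sum_j (a i * b j - a j * b i) ^+ 2.
  by apply: sumr_ge0 => i _; apply: sumr_ge0 => j _; exact: sqr_ge0.
suff -> : \sum_i \sum_j (a i * b j - a j * b i) ^+ 2 =
    ((\sum_i a i ^+ 2) * (\sum_i b i ^+ 2) - (\sum_i a i * b i) ^+ 2) *+ 2.
  by rewrite pmulrn_lge0// subr_ge0.
have -> : \sum_i \sum_j (a i * b j - a j * b i) ^+ 2 =
    \sum_i \sum_j (a i ^+ 2 * b j ^+ 2) + \sum_i \sum_j (a j ^+ 2 * b i ^+ 2) -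
    (\sum_i \sum_j (a i * b i) * (a j * b j)) *+ 2.
  rewrite -sumrMnl -big_split/= -sumrB; apply: eq_bigr => i _.
  rewrite -sumrMnl -big_split/= -sumrB; apply: eq_bigr => j _.
  by rewrite mulr2n; ring.
rewrite [X in _ + X - _]exchange_big/= expr2 !mulr_suml.
under [X in X + _ - _]eq_bigr do rewrite -mulr_sumr.
under [X in _ + X - _]eq_bigr do rewrite -mulr_sumr.
under [X in _ - X *+ 2]eq_bigr do rewrite -mulr_sumr.
by rewrite !mulr2n; ring.
Qed.

Section FrobeniusNorm.
Context {R : realType}.
Implicit Types m n p : nat.

Lemma fnorm_ge0 m n (A : 'M[R]_(m, n)) : 0 <= fnorm A.
Proof. exact: sqrtr_ge0. Qed.

Lemma fnorm_sqr m n (A : 'M[R]_(m, n)) :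
  fnorm A ^+ 2 = \sum_(i < m) \sum_(j < n) A i j ^+ 2.
Proof.
by rewrite sqr_sqrtr//; apply: sumr_ge0 => i _; apply: sumr_ge0 => j _;
  exact: sqr_ge0.
Qed.

Lemma fnorm_le m n (A : 'M[R]_(m, n)) (c : R) :
  0 <= c -> \sum_(i < m) \sum_(j < n) A i j ^+ 2 <= c ^+ 2 -> fnorm A <= c.
Proof.
by move=> c0; rewrite -fnorm_sqr ler_sqr// nnegrE// fnorm_ge0.
Qed.

Lemma norm2_fnorm n (x : 'cV[R]_n) : norm2 x = fnorm x.
Proof.
by rewrite /norm2 /fnorm; congr Num.sqrt; apply: eq_bigr => i _; rewrite big_ord1.
Qed.

Lemma fnorm_trace m n (A : 'M[R]_(m, n)) : fnorm A ^+ 2 = \tr (A *m A^T).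
Proof.
rewrite fnorm_sqr; apply: eq_bigr => i _; rewrite mxE.
by apply: eq_bigr => j _; rewrite mxE expr2.
Qed.

Lemma fnorm0 m n : fnorm (0 : 'M[R]_(m, n)) = 0.
Proof.
apply/eqP; rewrite -sqrf_eq0 fnorm_sqr big1// => i _.
by rewrite big1// => j _; rewrite mxE expr0n.
Qed.

Lemma fnormD m n (A B : 'M[R]_(m, n)) : fnorm (A + B) <= fnorm A + fnorm B.
Proof.
apply: fnorm_le; first by rewrite addr_ge0// fnorm_ge0.
(* Cauchy-Schwarz over index pairs, the matrices being read as long vectors. *)
have := sum_cauchy_schwarz (fun p : 'I_m * 'I_n => A p.1 p.2)
  (fun p : 'I_m * 'I_n => B p.1 p.2).
rewrite -(pair_bigA _ (fun i j => A i j * B i j))/=.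
rewrite -(pair_bigA _ (fun i j => A i j ^+ 2))/=.
rewrite -(pair_bigA _ (fun i j => B i j ^+ 2))/=.
move=> h; rewrite -!fnorm_sqr -exprMn in h.
have {h} AB : \sum_i \sum_j A i j * B i j <= fnorm A * fnorm B.
  apply: le_trans (ler_norm _) _.
  by rewrite -ler_sqr ?nnegrE ?mulr_ge0 ?fnorm_ge0// real_normK ?num_real.
have -> : \sum_i \sum_j (A + B) i j ^+ 2 =
    fnorm A ^+ 2 + fnorm B ^+ 2 + (\sum_i \sum_j A i j * B i j) *+ 2.
  rewrite !fnorm_sqr -sumrMnl -!big_split/=; apply: eq_bigr => i _.
  rewrite -sumrMnl -!big_split/=; apply: eq_bigr => j _.
  by rewrite mxE mulr2n; ring.
by rewrite sqrrD addrAC lerD2r lerD2l lerMn2r AB orbT.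
Qed.

Lemma fnorm_sum m n (I : finType) (F : I -> 'M[R]_(m, n)) :
  fnorm (\sum_i F i) <= \sum_i fnorm (F i).
Proof.
elim/big_rec2: _ => [|i y A _ h]; first by rewrite fnorm0.
by apply: le_trans (fnormD _ _) _; rewrite lerD2l.
Qed.

Lemma fnormM m n p (A : 'M[R]_(m, n)) (B : 'M[R]_(n, p)) :
  fnorm (A *m B) <= fnorm A * fnorm B.
Proof.
apply: fnorm_le; first by rewrite mulr_ge0// fnorm_ge0.
rewrite exprMn !fnorm_sqr mulr_suml; apply: ler_sum => i _.
rewrite [X in _ * X]exchange_big/= mulr_sumr; apply: ler_sum => j _.
by rewrite mxE; exact: sum_cauchy_schwarz.
Qed.

Lemma fnorm_mulr_orth m n (A : 'M[R]_(m, n)) (V : 'M[R]_n) :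
  V *m V^T = 1%:M -> fnorm (A *m V) = fnorm A.
Proof.
move=> VV; apply/eqP.
rewrite -(@eqrXn2 _ 2) ?fnorm_ge0// !fnorm_trace trmx_mul mulmxA.
by rewrite -(mulmxA A) VV mulmx1.
Qed.

Lemma fnorm_mull_orth m n (A : 'M[R]_(m, n)) (V : 'M[R]_m) :
  V^T *m V = 1%:M -> fnorm (V *m A) = fnorm A.
Proof.
move=> VV; apply/eqP.
rewrite -(@eqrXn2 _ 2) ?fnorm_ge0// !fnorm_trace trmx_mul mxtrace_mulC.
by rewrite mulmxA -(mulmxA _ V^T) VV mulmx1 mxtrace_mulC.
Qed.

Lemma norm2_le_spectral_norm m n (A : 'M[R]_(m, n)) (x : 'cV[R]_n) :
  norm2 x <= 1 -> norm2 (A *m x) <= spectral_norm A.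
Proof.
move=> x1; apply: ub_le_sup; last by exists x.
(* [sup] is a genuine least upper bound only if the set is bounded above; [fnorm A] bounds it on the
   unit ball. *)
exists (fnorm A) => _ [y /= y1 <-].
rewrite norm2_fnorm; apply: le_trans (fnormM _ _) _.
by rewrite ler_piMr ?fnorm_ge0// -norm2_fnorm.
Qed.

(** Each of the [n] columns is the image of a unit vector, so its Euclidean norm is at most [c]. *)
Lemma fnorm_le_spectral_norm n (A : 'M[R]_n) (c : R) :
  0 <= c -> spectral_norm A <= c -> fnorm A <= Num.sqrt n%:R * c.
Proof.
move=> c0 Ac; apply: fnorm_le; first by rewrite mulr_ge0// sqrtr_ge0.
rewrite exchange_big/= exprMn sqr_sqrtr ?ler0n//.
apply: (@le_trans _ _ (\sum_(j < n) c ^+ 2)); last first.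
  by rewrite sumr_const card_ord mulr_natl.
apply: ler_sum => j _.
have e1 : norm2 (delta_mx j 0 : 'cV[R]_n) <= 1.
  rewrite norm2_fnorm; apply: fnorm_le; rewrite ?ler01 ?expr1n//.
  rewrite (bigD1 j)//= big_ord1 mxE !eqxx expr1n big1 ?addr0// => i ij.
  by rewrite big_ord1 mxE (negPf ij) expr0n.
have := le_trans (norm2_le_spectral_norm A e1) Ac.
rewrite norm2_fnorm => Aj.
have : fnorm (A *m delta_mx j (0 : 'I_1)) ^+ 2 <= c ^+ 2.
  by rewrite ler_sqr ?nnegrE ?fnorm_ge0.
rewrite fnorm_sqr.
apply: le_trans; apply: ler_sum => i _; rewrite big_ord1 -colE mxE.
exact: lexx.
Qed.

End FrobeniusNorm.

(** * Divided differences of powers, over scalars and matrices *)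

(* The derivative of [a ^+ k] in direction [d] when [b = a]; in general the
   sum over [i + j = k - 1] of [a ^+ i * d * b ^+ j]. *)
Fixpoint pow_diff {A : pzRingType} (k : nat) (a d b : A) : A :=
  if k is l.+1 then a ^+ l * d + pow_diff l a d b * b else 0.

(** Telescoping; it identifies [pow_diff k a 1 b] as the divided difference of the [k]-th power when
    [a] and [b] differ. *)
Lemma pow_diff_sub {A : comPzRingType} (k : nat) (a b : A) :
  (a - b) * pow_diff k a 1 b = a ^+ k - b ^+ k.
Proof.
elim: k => [|k IH] /=; first by rewrite mulr0 !expr0 subrr.
by rewrite mulrDr (mulrA _ _ b) IH !exprSr; ring.
Qed.

Lemma horner_pow_diff {A : comNzRingType} (k : nat) (a b : A) :
  (pow_diff k 'X 1 b%:P).[a] = pow_diff k a 1 b.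
Proof.
by elim: k => [|k IH] /=; rewrite ?horner0// hornerD !hornerM hornerXn !hornerC IH.
Qed.

(** Conjugation by [V] turns each product [S ^+ p * D * S ^+ q] into [V D V^T] with row [i] scaled
    by [lam i ^+ p] and column [j] by [lam j ^+ q]. *)
Lemma pow_diff_diag (R : realType) n (V S D : 'M[R]_n) (lam : 'I_n -> R)
    (k : nat) (i j : 'I_n) :
    V^T *m V = 1%:M -> V *m S = diag_mx (\row_i lam i) *m V ->
  (V *m pow_diff k S D S *m V^T) i j =
  pow_diff k (lam i) 1 (lam j) * (V *m D *m V^T) i j.
Proof.
move=> VTV VS; set L := diag_mx _ in VS.
have VSk l : V *m S ^+ l = L ^+ l *m V.
  elim: l => [|l IH]; first by rewrite !expr0 mulmx1 mul1mx.
  by rewrite exprSr -mulmxE mulmxA IH -mulmxA VS mulmxA mulmxE -exprSr.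
have VVT := mulmx1C VTV.
have SV : S *m V^T = V^T *m L.
  rewrite -[LHS]mul1mx -VTV -!mulmxA (mulmxA V S) VS.
  by rewrite -!mulmxA VVT mulmx1.
have Lk l : L ^+ l = diag_mx (\row_i lam i ^+ l).
  elim: l => [|l IH].
    by rewrite expr0; apply/matrixP => a b; rewrite !mxE expr0.
  rewrite exprS IH -mulmxE mulmx_diag; congr diag_mx.
  by apply/rowP => a; rewrite !mxE exprS.
elim: k => [|k IH] /=; first by rewrite mulmx0 mul0mx mxE mul0r.
have -> : V *m (S ^+ k * D + pow_diff k S D S * S) *m V^T =
    L ^+ k *m (V *m D *m V^T) + V *m pow_diff k S D S *m V^T *m L.
  by rewrite mulmxDr mulmxDl -!mulmxE !mulmxA VSk -!mulmxA SV.
move: IH; move: (V *m D *m V^T) (V *m _ *m V^T) => X Y IH.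
by rewrite Lk mul_diag_mx mul_mx_diag !mxE IH; ring.
Qed.

(* A limit point [l] of [A] turns the Lipschitz bound on the difference
   quotients over [A] into a bound on the derivative at [l]. *)
Lemma lipschitz_pow_diff_le (R : realType) (I : Type) (lam : I -> R) (K : nat)
    (h : 'I_K -> R) (C : R) (i j : I) :
  lipschitz_constant lam (fun l => \sum_(k < K) h k * l ^+ k) C ->
  `|\sum_(k < K) h k * pow_diff k (lam i) 1 (lam j)| <= C.
Proof.
case=> A Alam hC.
(* The divided difference with one argument fixed at [lam j]; as a polynomial it is continuous even
   at [lam j], where a quotient would be undefined. *)
pose q : {poly R} := \sum_(k < K) (h k)%:P * pow_diff k 'X 1 (lam j)%:P.
have qE a : q.[a] = \sum_(k < K) h k * pow_diff k a 1 (lam j).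
  by rewrite horner_sum; apply: eq_bigr => k _; rewrite hornerM hornerC horner_pow_diff.
rewrite -qE.
(* Removing [lam j] from [A] keeps [lam i] a limit point and makes [u n - lam j] nonzero, so the
   cases [i = j] and [i != j] are treated alike. *)
have := limit_point_setD (finite_set1 (lam j)) (Alam i).2.
move=> /limit_pointP [u [uA _ ulam]].
have qu : `|q.[u n]| @[n --> \oo] --> `|q.[lam i]|.
  by apply: cvg_norm; apply: (cvg_comp _ _ ulam); exact: continuous_horner.
rewrite -(cvg_lim (@Rhausdorff R) qu).
apply: limr_le; first by apply/cvg_ex; eexists; exact: qu.
apply: nearW => n.
have [Aun unj] : (A `\ lam j) (u n) by apply: uA; exists n.
have /= := hC (u n, lam j) (conj Aun (Alam j).1).
rewrite -sumrB.
under eq_bigr do rewrite -mulrBr -pow_diff_sub mulrCA.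
rewrite -mulr_sumr -qE normrM mulrC ler_pM2r// normr_gt0 subr_eq0.
exact/eqP.
Qed.

(** * Orthonormal eigenbasis of a symmetric matrix *)

(** The rows of [V] are normalised left eigenvectors; since the eigenvalues are distinct, symmetry
    alone makes them orthogonal. *)
Lemma symmetric_orthogonal_diag (R : realType) n (S : 'M[R]_n)
    (lam : 'I_n -> R) :
    S^T = S -> is_spectrum S lam -> injective lam ->
  exists2 V : 'M[R]_n, V^T *m V = 1%:M &
    V *m S = diag_mx (\row_i lam i) *m V.
Proof.
move=> Ssym Slam laminj.
have /choice [v vP] (i : 'I_n) : exists v : 'rV[R]_n,
    v *m S = lam i *: v /\ v *m v^T = 1%:M.
  have : eigenvalue S (lam i).
    rewrite eigenvalue_root_char Slam /root horner_prod (bigD1 i)//=.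
    by rewrite hornerXsubC subrr mul0r.
  move=> /eigenvalueP [v vS v0].
  have fv : fnorm v != 0.
    apply: contra_neq v0 => fv0; apply/rowP => j; rewrite [RHS]mxE.
    have := fnorm_sqr v; rewrite fv0 expr0n big_ord1 => /esym/eqP.
    rewrite psumr_eq0; last by move=> k _; exact: sqr_ge0.
    by move=> /allP /(_ j (mem_index_enum _)); rewrite sqrf_eq0 => /eqP.
  exists ((fnorm v)^-1 *: v); split; first by rewrite -scalemxAl vS !scalerA mulrC.
  rewrite linearZ/= -scalemxAl -scalemxAr scalerA [v *m _]mx11_scalar.
  rewrite scale_scalar_mx -[X in _ * X]trace_mx11 -fnorm_trace.
  by congr (_%:M); rewrite expr2; field.
exists (\matrix_i v i).
  apply: mulmx1C; apply/matrixP => i j.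
  have -> : ((\matrix_i v i) *m (\matrix_i v i)^T) i j = (v i *m (v j)^T) 0 0.
    by rewrite !mxE; apply: eq_bigr => k _; rewrite !mxE.
  have [<-|ij] := eqVneq i j; first by rewrite (vP i).2 !mxE !eqxx.
  (* Both sides equal [v i *m S *m (v j)^T], with [S] acting to the left or, by symmetry, to the
     right. *)
  have : lam i *: (v i *m (v j)^T) = lam j *: (v i *m (v j)^T).
    rewrite scalemxAl -(vP i).1 -mulmxA -[X in X *m (v j)^T]Ssym -trmx_mul.
    by rewrite (vP j).1 linearZ/= scalemxAr.
  move=> /eqP; rewrite -subr_eq0 -scalerBl scaler_eq0 subr_eq0 (inj_eq laminj).
  by rewrite (negPf ij)/= => /eqP ->; rewrite !mxE (negPf ij).
apply/row_matrixP => i.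
by rewrite row_mul rowK (vP i).1 mul_diag_mx; apply/rowP => j; rewrite !mxE.
Qed.

(** * Perturbation bounds for matrix powers *)

(** The factor [fnorm 1] is there for [k = 0]: the Frobenius norm of the identity is not 1 in
    general. *)
Lemma fnormX_le (R : realType) n (A : 'M[R]_n) (k : nat) :
  fnorm (A ^+ k) <= fnorm (1 : 'M[R]_n) * fnorm A ^+ k.
Proof.
elim: k => [|k IH]; first by rewrite !expr0 mulr1.
rewrite !exprSr mulrA -mulmxE; apply: le_trans (fnormM _ _) _.
by rewrite ler_wpM2r ?fnorm_ge0.
Qed.

Lemma fnorm_subX_le (R : realType) n (A B : 'M[R]_n) (m : R) (k : nat) :
    1 <= m -> fnorm A <= m -> fnorm B <= m ->
  fnorm (B ^+ k - A ^+ k) <=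
  fnorm (1 : 'M[R]_n) * k%:R * m ^+ k * fnorm (B - A).
Proof.
move=> m1 Am Bm; have m0 : 0 <= m := le_trans ler01 m1.
elim: k => [|k IH]; first by rewrite !expr0 subrr fnorm0 mulr0 !mul0r.
have -> : B ^+ k.+1 - A ^+ k.+1 = (B ^+ k - A ^+ k) *m B + A ^+ k *m (B - A).
  by rewrite mulmxE !exprSr mulrBl mulrBr addrA subrK.
apply: le_trans (fnormD _ _) _.
rewrite -natr1 mulrDr !mulrDl mulr1; apply: lerD.
  apply: le_trans (fnormM _ _) _.
  by rewrite exprSr mulrA mulrAC ler_pM ?fnorm_ge0.
apply: le_trans (fnormM _ _) _; rewrite ler_wpM2r ?fnorm_ge0//.
apply: le_trans (fnormX_le _ _) _; rewrite ler_wpM2l ?fnorm_ge0//.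
apply: (@le_trans _ _ (m ^+ k)); first by rewrite lerXn2r ?nnegrE ?fnorm_ge0.
by rewrite ler_weXn2l.
Qed.

(** Raising [k] by one multiplies the remainder by [A] and adds [(B ^+ k - A ^+ k) *m (B - A)],
    quadratic by the previous lemma with a factor [k]; these factors sum to at most [k ^+ 2]. *)
Lemma fnorm_subX_pow_diff_le (R : realType) n (A B : 'M[R]_n) (m : R)
    (k : nat) :
    1 <= m -> fnorm A <= m -> fnorm B <= m ->
  fnorm (B ^+ k - A ^+ k - pow_diff k A (B - A) A) <=
  fnorm (1 : 'M[R]_n) * k%:R ^+ 2 * m ^+ k * fnorm (B - A) ^+ 2.
Proof.
move=> m1 Am Bm; have m0 : 0 <= m := le_trans ler01 m1.
elim: k => [|k IH] /=.
  by rewrite !expr0 subrr subr0 fnorm0 expr0n mulr0 !mul0r.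
set D := pow_diff _ _ _ _ in IH *.
have -> : B ^+ k.+1 - A ^+ k.+1 - (A ^+ k * (B - A) + D * A) =
    (B ^+ k - A ^+ k) *m (B - A) + (B ^+ k - A ^+ k - D) *m A.
  rewrite mulmxE !exprSr !mulrBl !mulrBr.
  (* The products are generalised so that [mxE] expands only sums and opposites. *)
  apply/matrixP => i j; move: (B ^+ k * B) (B ^+ k * A) (A ^+ k * B)
    (A ^+ k * A) (D * A) => ? ? ? ? ?; rewrite !mxE; ring.
apply: le_trans (fnormD _ _) _.
apply: le_trans (lerD (fnormM _ _) (fnormM _ _)) _.
have := fnorm_subX_le k m1 Am Bm.
move: IH; set r := fnorm _; set s := fnorm (_ - _); set e := fnorm (B - A).
set c := fnorm 1; set a := fnorm A => rle sle.
have e0 : 0 <= e := fnorm_ge0 _.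
have c0 : 0 <= c := fnorm_ge0 _.
have mk0 : 0 <= m ^+ k := exprn_ge0 k m0.
have k0 : 0 <= k%:R :> R := ler0n _ _.
apply: (@le_trans _ _ (c * k%:R * m ^+ k * e * e +
    c * k%:R ^+ 2 * m ^+ k * e ^+ 2 * m)).
  by rewrite lerD ?ler_wpM2r// ler_pM ?fnorm_ge0.
have ce0 : 0 <= c * m ^+ k * e ^+ 2 by rewrite !mulr_ge0 ?exprn_ge0.
rewrite -subr_ge0.
(* As [(k + 1)^2 - k^2 = 2 k + 1], the gap reduces to [(2 k + 1) m - k], split into two terms that
   are nonnegative because [1 <= m]. *)
have -> : c * k.+1%:R ^+ 2 * m ^+ k.+1 * e ^+ 2 -
    (c * k%:R * m ^+ k * e * e + c * k%:R ^+ 2 * m ^+ k * e ^+ 2 * m) =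
    c * m ^+ k * e ^+ 2 * (k%:R * (m - 1) + (k%:R + 1) * m).
  by rewrite -natr1 (exprSr m); ring.
by rewrite mulr_ge0// addr_ge0// mulr_ge0 ?subr_ge0 ?addr_ge0.
Qed.

(** * The first-order term and the final estimate *)

Lemma nv_filter_first_order_le (R : realType) (N K : nat) (S D : 'M[R]_N)
    (lam : 'I_N -> R) (H : 'M[R]_(N, K.+1)) (C : R) (x : 'cV[R]_N) :
    S^T = S -> is_spectrum S lam -> injective lam ->
    (forall t, lipschitz_constant lam (freq_response H t) C) ->
  norm2 ((\sum_(k < K.+1) diag_mx (col k H)^T *m pow_diff k S D S) *m x) <=
  Num.sqrt N%:R * (C * fnorm D * norm2 x).
Proof.
move=> Ssym Slam laminj HC.
have [V VTV VS] := symmetric_orthogonal_diag Ssym Slam laminj.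
have VVT := mulmx1C VTV.
(* Coefficients vary with the node, so each output entry gets its own matrix: in row [t] the
   diagonal factors act as the scalars [H t k]. *)
pose W t : 'M[R]_N := \sum_(k < K.+1) H t k *: (V *m pow_diff k S D S *m V^T).
have entry t : ((\sum_(k < K.+1) diag_mx (col k H)^T *m pow_diff k S D S) *m x)
    t 0 = (row t V^T *m W t *m (V *m x)) 0 0.
  have -> : row t V^T *m W t *m (V *m x) = row t (V^T *m W t *m V *m x).
    by rewrite !row_mul !mulmxA.
  rewrite [RHS]mxE mulmx_suml mulmx_sumr !mulmx_suml !summxE.
  apply: eq_bigr => k _.
  rewrite -scalemxAr -!scalemxAl [RHS]mxE !mulmxA VTV mul1mx.
  rewrite -(mulmxA _ V^T) VTV mulmx1 -mulmxA mul_diag_mx.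
  by move: (_ *m x) => y; rewrite !mxE.
have Wle t : fnorm (W t) <= C * fnorm D.
  (* The node [t] doubles as the index of an eigenvalue. *)
  have C0 : 0 <= C.
    exact: le_trans (normr_ge0 _) (lipschitz_pow_diff_le t t (HC t)).
  apply: fnorm_le; first by rewrite mulr_ge0 ?fnorm_ge0.
  have -> : fnorm D = fnorm (V *m D *m V^T).
    by rewrite fnorm_mulr_orth ?trmxK// fnorm_mull_orth.
  rewrite exprMn fnorm_sqr mulr_sumr; apply: ler_sum => i _.
  rewrite mulr_sumr; apply: ler_sum => j _.
  have -> : W t i j = (\sum_(k < K.+1) H t k * pow_diff k (lam i) 1 (lam j)) *
      (V *m D *m V^T) i j.
    rewrite summxE mulr_suml; apply: eq_bigr => k _.
    by rewrite mxE (pow_diff_diag _ _ _ _ VTV VS) mulrA.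
  rewrite exprMn ler_wpM2r ?sqr_ge0// -real_normK ?num_real//.
  by rewrite ler_sqr ?nnegrE//; exact: lipschitz_pow_diff_le (HC t).
have tle t : `|(row t V^T *m W t *m (V *m x)) 0 0| <= C * fnorm D * norm2 x.
  have -> (M : 'M[R]_1) : `|M 0 0| = fnorm M.
    by rewrite /fnorm !big_ord1 sqrtr_sqr.
  apply: le_trans (fnormM _ _) _; rewrite fnorm_mull_orth// norm2_fnorm.
  rewrite ler_wpM2r ?fnorm_ge0//; apply: le_trans (fnormM _ _) _.
  suff -> : fnorm (row t V^T) = 1 by rewrite mul1r.
  rewrite rowE fnorm_mulr_orth ?trmxK//; apply/eqP.
  rewrite -(@eqrXn2 _ 2) ?fnorm_ge0// fnorm_sqr big_ord1 (bigD1 t)//=.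
  rewrite mxE !eqxx big1 ?addr0 ?expr1n// => i it.
  by rewrite mxE (negPf it) expr0n.
(* Without nodes the sign of [C] is unconstrained, but both sides vanish. *)
have [N0|N0] := posnP N.
  rewrite [X in X <= _](_ : _ = 0).
    by rewrite [in Num.sqrt _]N0 sqrtr0 mul0r.
  by rewrite /norm2 big1 ?sqrtr0// => t; have := ltn_ord t; rewrite {2}N0.
have C0 := le_trans (normr_ge0 _) (tle (Ordinal N0)).
rewrite norm2_fnorm; apply: fnorm_le; first by rewrite mulr_ge0 ?sqrtr_ge0.
rewrite exprMn sqr_sqrtr ?ler0n// mulr_natl -[X in _ *+ X]card_ord -sumr_const.
apply: ler_sum => t _; rewrite big_ord1 entry -real_normK ?num_real//.
by rewrite ler_sqr ?nnegrE.
Qed.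

Theorem theorem3 (R : realType) (N K : nat)
    (E : rel 'I_N) (E_sym : symmetric E)
    (S : 'M[R]_N) (S_sym : S^T = S) (S_graph : graph_matrix E S)
    (lam : 'I_N -> R) (lam_spec : is_spectrum S lam) (lam_inj : injective lam)
    (H : 'M[R]_(N, K.+1))
    (C : R) (HC : forall t : 'I_N, lipschitz_constant lam (freq_response H t) C)
    (x : 'cV[R]_N) :
  exists2 r : R -> R,
    r =O_ (0^'+) (fun eps : R => eps ^+ 2) &
    forall (eps : R) (Ehat : rel 'I_N) (Shat : 'M[R]_N) (lamhat : 'I_N -> R),
      0 < eps ->
      symmetric Ehat ->
      Shat^T = Shat ->
      graph_matrix Ehat Shat ->
      is_spectrum Shat lamhat ->
      injective lamhat ->
      spectral_norm (Shat - S) <= eps ->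
      norm2 ((nv_filter H Shat - nv_filter H S) *m x)
        <= eps * C * Num.sqrt N%:R * (1 + 8 * N%:R) * norm2 x + r eps.
Proof.
set c := fnorm (1 : 'M[R]_N); set a := fnorm S; set sN : R := Num.sqrt N%:R.
(* The part of the [k]-th remainder bound free of [eps]; [N] comes from squaring
   [fnorm D <= sN * eps]. *)
pose w (k : nat) h : R :=
  fnorm (diag_mx h : 'M[R]_N) * (c * k%:R ^+ 2) * N%:R * norm2 x.
have sN0 : 0 <= sN := sqrtr_ge0 _.
have sN2 : sN * sN = N%:R by rewrite -expr2 sqr_sqrtr ?ler0n.
have a0 : 0 <= a := fnorm_ge0 _.
have x0 : 0 <= norm2 x := sqrtr_ge0 _.
have w0 k h : 0 <= w k h by rewrite !mulr_ge0 ?fnorm_ge0 ?sqr_ge0.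
(* The base of the powers dominates 1, [fnorm S] and every admissible [fnorm Shat], so the remainder
   can be chosen before [Shat]. *)
pose p (eps : R) : R :=
  \sum_(k < K.+1) w k (col k H)^T * (1 + a + sN * eps) ^+ k.
have m0 (eps : R) : 0 <= eps -> 0 <= 1 + a + sN * eps.
  by move=> e0; rewrite !addr_ge0 ?mulr_ge0.
have p0 eps : 0 <= eps -> 0 <= p eps.
  by move=> e0; apply: sumr_ge0 => k _; rewrite mulr_ge0// exprn_ge0// m0.
exists (fun eps => p eps * eps ^+ 2).
  (* On [0 < e <= 1] monotonicity gives [p e <= p 1]; adding 1 makes the constant positive. *)
  apply/eqO_exP; exists (1 + p 1); first by rewrite ltr_pwDl// p0.
  near=> e.
  have e0 : 0 < e by near: e; exact: nbhs_right_gt.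
  have e1 : e <= 1 by near: e; apply: nbhs_right_le.
  rewrite normrM ler_wpM2r// ger0_norm ?p0 ?(ltW e0)//.
  apply: (@le_trans _ _ (p 1)); last by rewrite lerDr.
  apply: ler_sum => k _; rewrite ler_wpM2l// lerXn2r ?nnegrE ?m0 ?(ltW e0)//.
  by rewrite lerD2l ler_wpM2l.
move=> eps Ehat Shat lamhat eps0 _ _ _ _ _ Se.
have e0 := ltW eps0.
set D := Shat - S in Se *.
have De : fnorm D <= sN * eps by exact: fnorm_le_spectral_norm.
pose m := 1 + a + sN * eps.
have m1 : 1 <= m by rewrite /m -addrA lerDl addr_ge0// mulr_ge0.
have am : a <= m by rewrite /m addrAC lerDr addr_ge0// mulr_ge0.
have Sm : fnorm Shat <= m.
  rewrite -(subrK S Shat) addrC -/D.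
  by apply: le_trans (fnormD _ _) _; rewrite /m -addrA ler_wpDl// lerD2l.
have -> : (nv_filter H Shat - nv_filter H S) *m x =
    (\sum_(k < K.+1) diag_mx (col k H)^T *m pow_diff k S D S) *m x +
    (\sum_(k < K.+1) diag_mx (col k H)^T *m
       (Shat ^+ k - S ^+ k - pow_diff k S D S)) *m x.
  rewrite -mulmxDl -big_split/= -sumrB; congr (_ *m x); apply: eq_bigr => k _.
  by rewrite -mulmxBr -mulmxDr [pow_diff _ _ _ _ + _]addrC subrK.
rewrite norm2_fnorm; apply: le_trans (fnormD _ _) _; apply: lerD.
  rewrite -norm2_fnorm.
  apply: le_trans (nv_filter_first_order_le D x S_sym lam_spec lam_inj HC) _.
  (* The product is nonnegative even for [N = 0], where [C] may be negative but [sN] is 0. *)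
  have C0 : 0 <= C * sN.
    rewrite /sN; case: (posnP N) => [->|N0]; first by rewrite sqrtr0 mulr0.
    rewrite mulr_ge0//.
    have := lipschitz_pow_diff_le (Ordinal N0) (Ordinal N0) (HC (Ordinal N0)).
    exact: le_trans (normr_ge0 _).
  rewrite -/sN !mulrA [sN * C]mulrC ler_wpM2r//.
  apply: (le_trans (ler_wpM2l C0 De)).
  have -> : C * sN * (sN * eps) = C * sN * eps * sN by ring.
  have -> : eps * C * sN = C * sN * eps by ring.
  rewrite ler_wpM2l ?(mulr_ge0 C0)// -sN2.
  (* What remains is [sN <= 1 + 8 * (sN * sN)]. *)
  by nra.
apply: le_trans (fnormM _ _) _; rewrite -norm2_fnorm.
apply: le_trans (ler_wpM2r x0 (fnorm_sum _)) _.
rewrite /p !mulr_suml; apply: ler_sum => k _.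
apply: le_trans (ler_wpM2r x0 (fnormM _ _)) _.
have D2 : fnorm D ^+ 2 <= N%:R * eps ^+ 2.
  by rewrite -sN2 -expr2 -exprMn lerXn2r ?nnegrE ?fnorm_ge0 ?mulr_ge0.
have := fnorm_subX_pow_diff_le k m1 am Sm; rewrite -/D -/c => rle.
have cm0 : 0 <= c * k%:R ^+ 2 * m ^+ k.
  by rewrite !mulr_ge0 ?fnorm_ge0 ?exprn_ge0 ?m0.
have {}rle := le_trans rle (ler_wpM2l cm0 D2).
apply: le_trans (ler_wpM2r x0 (ler_wpM2l (fnorm_ge0 _) rle)) _.
by rewrite /w -/m le_eqVlt; apply/orP; left; apply/eqP; ring.
Unshelve. all: by end_near.
Qed.
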